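(* Let $\mathcal M=(\mathcal C,\mathsf T)$ be a CBPV model. If every morphism of the form $f:X\to TY$ in $\mathcal C$ is lax discardable, lax copyable, and lax central, then for every source-language expression $\Gamma\vdash e:\tau$ we have $$\mathcal V[\![e]\!]\ \ltimes\ \mathcal N[\![e]\!].$$
   Context: **Order-enriched notions.** A Poset-category is a category $\mathcal C$ with a partial order $\sqsubseteq$ on each hom-set such that composition is monotone. It is cartesian if it has a terminal object $1$ (unique maps $\langle\rangle_X:X\to 1$) and binary products (projections $\pi_i$) with monotone pairing $\langle-,-\rangle$; $\mathrm{assoc}:(X_1\times X_2)\times X_3\to X_1\times(X_2\times X_3)$ is the canonical isomorphism. It is cartesian closed if moreover it has exponentials $X\Rightarrow Y$ with monotone currying $\Lambda:\mathcal C(W\times X,Y)\to\mathcal C(W,X\Rightarrow Y)$; $\mathrm{ev}=\Lambda^{-1}\mathrm{id}:(X\Rightarrow Y)\times X\to Y$. Binary coproducts are required to have monotone copairing $[-,-]$. A strong Poset-monad $\mathsf T$ on a cartesian $\mathcal C$ consists of objects $TX$, morphisms $\eta_X:X\to TX$, and monotone functions $(-)^{\dagger(W\times\square)}:\mathcal C(W\times X,TY)\to\mathcal C(W\times TX,TY)$ such that: $f^{\dagger(W\times\square)}\circ(w\times \mathrm{id})=(f\circ(w\times\mathrm{id}))^{\dagger(W'\times\square)}$ for $w:W'\to W$; $f^{\dagger(W\times\square)}\circ(\mathrm{id}_W\times\eta_X)=f$; $(\eta_X\circ\pi_2)^{\dagger(1\times\square)}=\pi_2$; and $(g^{\dagger(W'\times\square)}\circ(\mathrm{id}_{W'}\times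 f)\circ\mathrm{assoc})^{\dagger((W'\times W)\times\square)}=g^{\dagger(W'\times\square)}\circ(\mathrm{id}_{W'}\times f^{\dagger(W\times\square)})\circ\mathrm{assoc}$ for $f:W\times X\to TY$, $g:W'\times Y\to TZ$. A $\mathsf T$-algebra $\mathsf Z$ is an object $Z=U_{\mathsf T}\mathsf Z$ (the carrier) with monotone functions $(-)^{\ddagger(W\times\square)}:\mathcal C(W\times X,Z)\to\mathcal C(W\times TX,Z)$ satisfying the same naturality in $W$, the left unit law $f^{\ddagger(W\times\square)}\circ(\mathrm{id}_W\times\eta_X)=f$, and associativity $(g^{\ddagger(W'\times\square)}\circ(\mathrm{id}_{W'}\times f)\circ\mathrm{assoc})^{\ddagger((W'\times W)\times\square)}=g^{\ddagger(W'\times\square)}\circ(\mathrm{id}_{W'}\times f^{\dagger(W\times\square)})\circ\mathrm{assoc}$ for $f:W\times X\to TY$, $g:W'\times Y\to Z$. Derived notation: for $f:X\to TY$, $f^\dagger:TX\to TY$ is the case $W=1$ (using $1\times X\cong X$); $Tf=(\eta_Y\circ f)^\dagger$ for $f:X\to Y$; $f^{\dagger(\square\times W)}=(f\circ\langle\pi_2,\pi_1\rangle)^{\dagger(W\times\square)}\circ\langle\pi_2,\pi_1\rangle:TX\times W\to TY$ for $f:X\times W\to TY$; $\mathrm{seq}^{L}_{X_1,X_2}=(\eta_{X_1\times X_2}^{\dagger(X_1\times\square)})^{\dagger(\square\times TX_2)}$ and $\mathrm{seq}^{R}_{X_1,X_2}=(\eta_{X_1\times X_2}^{\dagger(\square\times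 X_2)})^{\dagger(TX_1\times\square)}$, both $TX_1\times TX_2\to T(X_1\times X_2)$; $\langle\!\langle f_1,f_2\rangle\!\rangle=\mathrm{seq}^{L}\circ\langle f_1,f_2\rangle:W\to T(X_1\times X_2)$ for $f_i:W\to TX_i$. A morphism $f:X\to TY$ is lax discardable if $T\langle\rangle_Y\circ f\sqsubseteq\eta_1\circ\langle\rangle_X$; lax copyable if $T\langle\mathrm{id}_Y,\mathrm{id}_Y\rangle\circ f\sqsubseteq\mathrm{seq}^L_{Y,Y}\circ\langle f,f\rangle$; lax central if $\mathrm{seq}^L_{Y,W}\circ(f\times\mathrm{id}_{TW})\sqsubseteq\mathrm{seq}^R_{Y,W}\circ(f\times\mathrm{id}_{TW})$ for all objects $W$. Algebra constructions: the free algebra $F_{\mathsf T}X$ has carrier $TX$ and extension $(-)^{\dagger(W\times\square)}$; the product $\mathsf Z_1\times\mathsf Z_2$ has carrier $Z_1\times Z_2$ and $f^{\ddagger(W\times\square)}=\langle(\pi_1\circ f)^{\ddagger(W\times\square)},(\pi_2\circ f)^{\ddagger(W\times\square)}\rangle$; the power $Y\Rightarrow\mathsf Z$ has carrier $Y\Rightarrow Z$ and $f^{\ddagger(W\times\square)}=\Lambda\big((\Lambda^{-1}f\circ\beta_{W,Y,X})^{\ddagger((W\times Y)\times\square)}\circ\beta_{W,TX,Y}\big)$, where $\beta_{X_1,X_2,X_3}:(X_1\times X_2)\times X_3\to(X_1\times X_3)\times X_2$ is the canonical isomorphism. A CBPV model $\mathcal M=(\mathcal C,\mathsf T)$ is a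 cartesian closed Poset-category $\mathcal C$ admitting the coproduct $2=1+1$ (coprojections $\mathrm{inl},\mathrm{inr}$), with a strong Poset-monad $\mathsf T$ on $\mathcal C$. Then $W+W$ exists for all $W$, and $\mathrm{dist}_W:W\times2\to W+W$ denotes the inverse of the canonical map. **Source language.** Types $\tau::=\mathbf{unit}\mid\mathbf{bool}\mid\tau_1\times\tau_2\mid\tau\to\tau'$; expressions $e::=x\mid()\mid(e_1,e_2)\mid\mathbf{fst}\,e\mid\mathbf{snd}\,e\mid\mathbf{true}\mid\mathbf{false}\mid\mathbf{if}\,e_0\,\mathbf{then}\,e_1\,\mathbf{else}\,e_2\mid\lambda x{:}\tau.e\mid e\,e'$, with the usual simply typed rules $\Gamma\vdash e:\tau$. **Call-by-value semantics.** $\mathcal V[\![\mathbf{unit}]\!]=1$, $\mathcal V[\![\mathbf{bool}]\!]=2$, $\mathcal V[\![\tau_1\times\tau_2]\!]=\mathcal V[\![\tau_1]\!]\times\mathcal V[\![\tau_2]\!]$, $\mathcal V[\![\tau\to\tau']\!]=\mathcal V[\![\tau]\!]\Rightarrow T\mathcal V[\![\tau']\!]$; contexts: $\mathcal V[\![\diamond]\!]=1$, $\mathcal V[\![\Gamma,x:\tau]\!]=\mathcal V[\![\Gamma]\!]\times\mathcal V[\![\tau]\!]$. For $\Gamma\vdash e:\tau$, $\mathcal V[\![e]\!]:\mathcal V[\![\Gamma]\!]\to T\mathcal V[\![\tau]\!]$: $x\mapsto\eta\circ\pi_x$; $()\mapsto\eta_1\circ\langle\rangle$; $(e_1,e_2)\mapsto\langle\!\langle\mathcal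 V[\![e_1]\!],\mathcal V[\![e_2]\!]\rangle\!\rangle$; $\mathbf{fst}\,e\mapsto T\pi_1\circ\mathcal V[\![e]\!]$; $\mathbf{snd}\,e\mapsto T\pi_2\circ\mathcal V[\![e]\!]$; $\mathbf{true}\mapsto\eta_2\circ\mathrm{inl}\circ\langle\rangle$; $\mathbf{false}\mapsto\eta_2\circ\mathrm{inr}\circ\langle\rangle$; $\mathbf{if}\,e_0\,\mathbf{then}\,e_1\,\mathbf{else}\,e_2\mapsto([\mathcal V[\![e_1]\!],\mathcal V[\![e_2]\!]]\circ\mathrm{dist})^{\dagger(\mathcal V[\![\Gamma]\!]\times\square)}\circ\langle\mathrm{id},\mathcal V[\![e_0]\!]\rangle$; $\lambda x{:}\tau.e\mapsto\eta\circ\Lambda(\mathcal V[\![e]\!])$; $e\,e'\mapsto\mathrm{ev}^\dagger\circ\langle\!\langle\mathcal V[\![e]\!],\mathcal V[\![e']\!]\rangle\!\rangle$. **Call-by-name semantics.** As $\mathsf T$-algebras: $\mathcal N[\![\mathbf{unit}]\!]=F_{\mathsf T}1$, $\mathcal N[\![\mathbf{bool}]\!]=F_{\mathsf T}2$, $\mathcal N[\![\tau_1\times\tau_2]\!]=\mathcal N[\![\tau_1]\!]\times\mathcal N[\![\tau_2]\!]$, $\mathcal N[\![\tau\to\tau']\!]=U_{\mathsf T}\mathcal N[\![\tau]\!]\Rightarrow\mathcal N[\![\tau']\!]$; contexts: $\mathcal N[\![\diamond]\!]=1$, $\mathcal N[\![\Gamma,x:\tau]\!]=\mathcal N[\![\Gamma]\!]\times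 U_{\mathsf T}\mathcal N[\![\tau]\!]$. For $\Gamma\vdash e:\tau$, $\mathcal N[\![e]\!]:\mathcal N[\![\Gamma]\!]\to U_{\mathsf T}\mathcal N[\![\tau]\!]$: $x\mapsto\pi_x$; $()\mapsto\eta_1\circ\langle\rangle$; $(e_1,e_2)\mapsto\langle\mathcal N[\![e_1]\!],\mathcal N[\![e_2]\!]\rangle$; $\mathbf{fst}\,e\mapsto\pi_1\circ\mathcal N[\![e]\!]$; $\mathbf{snd}\,e\mapsto\pi_2\circ\mathcal N[\![e]\!]$; $\mathbf{true}\mapsto\eta_2\circ\mathrm{inl}\circ\langle\rangle$; $\mathbf{false}\mapsto\eta_2\circ\mathrm{inr}\circ\langle\rangle$; $\mathbf{if}\,e_0\,\mathbf{then}\,e_1\,\mathbf{else}\,e_2\mapsto([\mathcal N[\![e_1]\!],\mathcal N[\![e_2]\!]]\circ\mathrm{dist})^{\ddagger(\mathcal N[\![\Gamma]\!]\times\square)}\circ\langle\mathrm{id},\mathcal N[\![e_0]\!]\rangle$; $\lambda x{:}\tau.e\mapsto\Lambda(\mathcal N[\![e]\!])$; $e\,e'\mapsto\mathrm{ev}\circ\langle\mathcal N[\![e]\!],\mathcal N[\![e']\!]\rangle$. **The relations.** For $f^v:W\to T\mathcal V[\![\tau]\!]$ and $f^n:W\to U_{\mathsf T}\mathcal N[\![\tau]\!]$, define $f^v\,\mathcal R[\![\tau]\!]_W\,f^n$ by induction on $\tau$: for $\tau\in\{\mathbf{unit},\mathbf{bool}\}$, iff $f^v\sqsubseteq f^n$;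 for $\tau_1\times\tau_2$, iff $(T\pi_i\circ f^v)\,\mathcal R[\![\tau_i]\!]_W\,(\pi_i\circ f^n)$ for $i=1,2$; for $\tau\to\tau'$, iff for all $W'$, $w:W'\to W$, $g^v:W'\to T\mathcal V[\![\tau]\!]$, $g^n:W'\to U_{\mathsf T}\mathcal N[\![\tau]\!]$, $g^v\,\mathcal R[\![\tau]\!]_{W'}\,g^n$ implies $(\mathrm{ev}^\dagger\circ\langle\!\langle f^v\circ w,g^v\rangle\!\rangle)\,\mathcal R[\![\tau']\!]_{W'}\,(\mathrm{ev}\circ\langle f^n\circ w,g^n\rangle)$. Write $\langle f_i\rangle_i$ for iterated (left-nested) pairing, starting from $\langle\rangle_W$, and $\langle\!\langle f_i\rangle\!\rangle_i$ for iterated (left-nested) $\langle\!\langle-,-\rangle\!\rangle$, starting from $\eta_1\circ\langle\rangle_W$. For $\Gamma=x_1:\tau_1,\dots,x_k:\tau_k$, $g^v:\mathcal V[\![\Gamma]\!]\to T\mathcal V[\![\tau]\!]$ and $g^n:\mathcal N[\![\Gamma]\!]\to U_{\mathsf T}\mathcal N[\![\tau]\!]$, write $g^v\ltimes g^n$ if for all objects $W$ and families $f_i^v:W\to T\mathcal V[\![\tau_i]\!]$, $f_i^n:W\to U_{\mathsf T}\mathcal N[\![\tau_i]\!]$ with $f_i^v\,\mathcal R[\![\tau_i]\!]_W\,f_i^n$ for all $i$, we have $((g^v)^\dagger\circ\langle\!\langle f_i^v\rangle\!\rangle_i)\,\mathcal R[\![\tau]\!]_W\,(g^n\circ\langle f_i^n\rangle_i)$.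 *)

(* Defs.v *)
From Stdlib Require Import List.
Import ListNotations.

Set Implicit Arguments.
Unset Strict Implicit.
Unset Printing Implicit Defensive.

Declare Scope cat_scope.
Delimit Scope cat_scope with cat.
Open Scope cat_scope.

Reserved Notation "X ~> Y" (at level 90, right associativity).
Reserved Notation "g ∘ f" (at level 40, left associativity).
Reserved Notation "f ⊑ g" (at level 70, no associativity).
Reserved Notation "X × Y" (at level 39, left associativity).
Reserved Notation "X ⇒ Y" (at level 60, right associativity).
Reserved Notation "⟨ f , g ⟩" (at level 0, f at level 99, g at level 99).
Reserved Notation "⟪ f , g ⟫" (at level 0, f at level 99, g at level 99).

Record poset_category := {
  ob :> Type;
  hom : ob -> ob -> Type;
  hom_le : forall X Y, hom X Y -> hom X Y -> Prop;
  idm : forall X, hom X X;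
  comp : forall X Y Z, hom Y Z -> hom X Y -> hom X Z;
  le_refl : forall X Y (f : hom X Y), hom_le f f;
  le_trans : forall X Y (f g h : hom X Y),
    hom_le f g -> hom_le g h -> hom_le f h;
  le_antisym : forall X Y (f g : hom X Y),
    hom_le f g -> hom_le g f -> f = g;
  comp_mono : forall X Y Z (g g' : hom Y Z) (f f' : hom X Y),
    hom_le g g' -> hom_le f f' -> hom_le (comp g f) (comp g' f');
  comp_idl : forall X Y (f : hom X Y), comp (idm Y) f = f;
  comp_idr : forall X Y (f : hom X Y), comp f (idm X) = f;
  comp_assoc : forall X Y Z W (h : hom Z W) (g : hom Y Z) (f : hom X Y),
    comp h (comp g f) = comp (comp h g) f }.

Arguments idm {p} X.

Notation "X ~> Y" := (hom X Y) : cat_scope.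
Notation "g ∘ f" := (comp g f) : cat_scope.
Notation "f ⊑ g" := (hom_le f g) : cat_scope.

Record cartesian := {
  cart_cat :> poset_category;
  one : cart_cat;
  bang : forall X : cart_cat, X ~> one;
  bang_unique : forall (X : cart_cat) (f : X ~> one), f = bang X;
  prd : cart_cat -> cart_cat -> cart_cat;
  π1 : forall X Y, prd X Y ~> X;
  π2 : forall X Y, prd X Y ~> Y;
  pairing : forall W X Y, (W ~> X) -> (W ~> Y) -> (W ~> prd X Y);
  pair_π1 : forall W X Y (f : W ~> X) (g : W ~> Y), π1 X Y ∘ pairing f g = f;
  pair_π2 : forall W X Y (f : W ~> X) (g : W ~> Y), π2 X Y ∘ pairing f g = g;
  pair_unique : forall W X Y (h : W ~> prd X Y),
    h = pairing (π1 X Y ∘ h) (π2 X Y ∘ h);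
  pair_mono : forall W X Y (f f' : W ~> X) (g g' : W ~> Y),
    f ⊑ f' -> g ⊑ g' -> pairing f g ⊑ pairing f' g' }.

Arguments one {c}.
Arguments bang {c} X.
Arguments π1 {c X Y}.
Arguments π2 {c X Y}.

Notation "X × Y" := (prd X Y) : cat_scope.
Notation "⟨ f , g ⟩" := (pairing f g) : cat_scope.

Definition prod_map {C : cartesian} {X X' Y Y' : C}
  (f : X ~> X') (g : Y ~> Y') : X × Y ~> X' × Y' := ⟨f ∘ π1, g ∘ π2⟩.

Definition assoc {C : cartesian} {X1 X2 X3 : C} :
  (X1 × X2) × X3 ~> X1 × (X2 × X3) := ⟨π1 ∘ π1, ⟨π2 ∘ π1, π2⟩⟩.

Definition swap {C : cartesian} {X Y : C} : X × Y ~> Y × X := ⟨π2, π1⟩.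

Definition braid {C : cartesian} {X1 X2 X3 : C} :
  (X1 × X2) × X3 ~> (X1 × X3) × X2 := ⟨⟨π1 ∘ π1, π2⟩, π2 ∘ π1⟩.

Record cartesian_closed := {
  ccc_cart :> cartesian;
  exp_ob : ccc_cart -> ccc_cart -> ccc_cart;
  curry : forall W X Y : ccc_cart, (W × X ~> Y) -> (W ~> exp_ob X Y);
  uncurry : forall W X Y : ccc_cart, (W ~> exp_ob X Y) -> (W × X ~> Y);
  curryK : forall (W X Y : ccc_cart) (f : W × X ~> Y), uncurry (curry f) = f;
  uncurryK : forall (W X Y : ccc_cart) (g : W ~> exp_ob X Y),
    curry (uncurry g) = g;
  curry_nat : forall (W W' X Y : ccc_cart) (f : W × X ~> Y) (w : W' ~> W),
    curry (f ∘ prod_map w (idm X)) = curry f ∘ w;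
  curry_mono : forall (W X Y : ccc_cart) (f f' : W × X ~> Y),
    f ⊑ f' -> curry f ⊑ curry f' }.

Notation "X ⇒ Y" := (exp_ob X Y) : cat_scope.

Definition ev {C : cartesian_closed} {X Y : C} : (X ⇒ Y) × X ~> Y :=
  uncurry (idm (X ⇒ Y)).

Record coproduct (C : poset_category) (X1 X2 : C) := {
  cop_ob :> C;
  inj1 : X1 ~> cop_ob;
  inj2 : X2 ~> cop_ob;
  copair : forall Y, (X1 ~> Y) -> (X2 ~> Y) -> (cop_ob ~> Y);
  copair_inj1 : forall Y (f : X1 ~> Y) (g : X2 ~> Y), copair f g ∘ inj1 = f;
  copair_inj2 : forall Y (f : X1 ~> Y) (g : X2 ~> Y), copair f g ∘ inj2 = g;
  copair_unique : forall Y (h : cop_ob ~> Y), h = copair (h ∘ inj1) (h ∘ inj2);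
  copair_mono : forall Y (f f' : X1 ~> Y) (g g' : X2 ~> Y),
    f ⊑ f' -> g ⊑ g' -> copair f g ⊑ copair f' g' }.

Arguments inj1 {C X1 X2 c}.
Arguments inj2 {C X1 X2 c}.
Arguments copair {C X1 X2 c Y} f g.

(* [bind f] is the extension of [f] along [W × □] *)
Record strong_monad (C : cartesian) := {
  mon_ob :> C -> C;
  η : forall X : C, X ~> mon_ob X;
  bind : forall W X Y : C, (W × X ~> mon_ob Y) -> (W × mon_ob X ~> mon_ob Y);
  bind_mono : forall (W X Y : C) (f f' : W × X ~> mon_ob Y),
    f ⊑ f' -> bind f ⊑ bind f';
  bind_nat : forall (W W' X Y : C) (f : W × X ~> mon_ob Y) (w : W' ~> W),
    bind f ∘ prod_map w (idm (mon_ob X)) = bind (f ∘ prod_map w (idm X));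
  bind_η : forall (W X Y : C) (f : W × X ~> mon_ob Y),
    bind f ∘ prod_map (idm W) (η X) = f;
  bind_ret : forall X : C, bind (η X ∘ π2 (X := one)) = π2;
  bind_assoc : forall (W W' X Y Z : C)
      (f : W × X ~> mon_ob Y) (g : W' × Y ~> mon_ob Z),
    bind (bind g ∘ prod_map (idm W') f ∘ assoc)
    = bind g ∘ prod_map (idm W') (bind f) ∘ assoc }.

Arguments η {C s} X.
Arguments bind {C s W X Y} f.

Record algebra (C : cartesian) (T : strong_monad C) := {
  carrier :> C;
  aext : forall W X : C, (W × X ~> carrier) -> (W × T X ~> carrier);
  aext_mono : forall (W X : C) (f f' : W × X ~> carrier),
    f ⊑ f' -> aext f ⊑ aext f';
  aext_nat : forall (W W' X : C) (f : W × X ~> carrier) (w : W' ~> W),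
    aext f ∘ prod_map w (idm (T X)) = aext (f ∘ prod_map w (idm X));
  aext_η : forall (W X : C) (f : W × X ~> carrier),
    aext f ∘ prod_map (idm W) (η X) = f;
  aext_assoc : forall (W W' X Y : C)
      (f : W × X ~> T Y) (g : W' × Y ~> carrier),
    aext (aext g ∘ prod_map (idm W') f ∘ assoc)
    = aext g ∘ prod_map (idm W') (bind f) ∘ assoc }.

Arguments aext {C T} a {W X} f.

Section Derived.
Context {C : cartesian} {T : strong_monad C}.

(* the case [W = 1] of [bind], transported along [1 × X ≅ X] *)
Definition lift {X Y : C} (f : X ~> T Y) : T X ~> T Y :=
  bind (f ∘ π2 (X := one)) ∘ ⟨bang (T X), idm (T X)⟩.

Definition fmap {X Y : C} (f : X ~> Y) : T X ~> T Y := lift (η Y ∘ f).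

(* the extension of [f] along [□ × W] *)
Definition bindl {W X Y : C} (f : X × W ~> T Y) : T X × W ~> T Y :=
  bind (f ∘ swap) ∘ swap.

Definition seqL {X1 X2 : C} : T X1 × T X2 ~> T (X1 × X2) :=
  bindl (bind (η (X1 × X2))).

Definition seqR {X1 X2 : C} : T X1 × T X2 ~> T (X1 × X2) :=
  bind (bindl (η (X1 × X2))).

Definition pairL {W X1 X2 : C} (f1 : W ~> T X1) (f2 : W ~> T X2) :
  W ~> T (X1 × X2) := seqL ∘ ⟨f1, f2⟩.

Definition lax_discardable {X Y : C} (f : X ~> T Y) : Prop :=
  fmap (bang Y) ∘ f ⊑ η one ∘ bang X.

Definition lax_copyable {X Y : C} (f : X ~> T Y) : Prop :=
  fmap ⟨idm Y, idm Y⟩ ∘ f ⊑ seqL ∘ ⟨f, f⟩.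

Definition lax_central {X Y : C} (f : X ~> T Y) : Prop :=
  forall W : C, seqL ∘ prod_map f (idm (T W)) ⊑ seqR ∘ prod_map f (idm (T W)).

End Derived.

Notation "⟪ f , g ⟫" := (pairL f g) : cat_scope.

Lemma pair_comp {C : cartesian} {V W X Y : C}
  (f : W ~> X) (g : W ~> Y) (h : V ~> W) : ⟨f, g⟩ ∘ h = ⟨f ∘ h, g ∘ h⟩.
Proof.
rewrite (pair_unique (⟨f, g⟩ ∘ h)), !comp_assoc, pair_π1, pair_π2.
reflexivity.
Qed.

Lemma pair_id {C : cartesian} {X Y : C} : ⟨π1, π2⟩ = idm (X × Y).
Proof.
rewrite (pair_unique (idm (X × Y))), !comp_idr; reflexivity.
Qed.

Lemma pair_eta {C : cartesian} {W X Y : C} (h : W ~> X × Y) :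
  ⟨π1 ∘ h, π2 ∘ h⟩ = h.
Proof. symmetry; apply pair_unique. Qed.

Ltac cat_norm :=
  unfold prod_map, assoc, swap, braid;
  repeat progress
    rewrite <- ?comp_assoc, ?pair_comp, ?pair_π1, ?pair_π2,
      ?comp_idl, ?comp_idr, ?pair_id, ?pair_eta.

Lemma uncurry_nat {C : cartesian_closed} {W W' X Y : C}
  (g : W ~> X ⇒ Y) (w : W' ~> W) :
  uncurry (g ∘ w) = uncurry g ∘ prod_map w (idm X).
Proof.
rewrite <- (uncurryK g) at 1.
rewrite <- curry_nat, curryK; reflexivity.
Qed.

Lemma uncurry_mono {C : cartesian_closed} {W X Y : C} (g g' : W ~> X ⇒ Y) :
  g ⊑ g' -> uncurry g ⊑ uncurry g'.
Proof.
intro le_g.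
rewrite <- (comp_idl g), <- (comp_idl g'), !uncurry_nat.
apply comp_mono; [apply le_refl|].
apply pair_mono; [|apply le_refl].
apply comp_mono; [exact le_g|apply le_refl].
Qed.

Definition free_algebra {C : cartesian} (T : strong_monad C) (X : C) :
  algebra T :=
  {| carrier := T X;
     aext := fun W Y f => bind f;
     aext_mono := fun W Y f f' => @bind_mono C T W Y X f f';
     aext_nat := fun W W' Y f w => bind_nat f w;
     aext_η := fun W Y f => bind_η f;
     aext_assoc := fun W W' Y Z f g => bind_assoc f g |}.

Section ProductAlgebra.
Context {C : cartesian} {T : strong_monad C} (Z1 Z2 : algebra T).

Definition prod_aext {W X : C} (f : W × X ~> Z1 × Z2) :
  W × T X ~> Z1 × Z2 := ⟨aext Z1 (π1 ∘ f), aext Z2 (π2 ∘ f)⟩.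

Lemma prod_aext_mono (W X : C) (f f' : W × X ~> Z1 × Z2) :
  f ⊑ f' -> prod_aext f ⊑ prod_aext f'.
Proof.
intro le_f; apply pair_mono; apply aext_mono;
  (apply comp_mono; [apply le_refl|exact le_f]).
Qed.

Lemma prod_aext_nat (W W' X : C) (f : W × X ~> Z1 × Z2) (w : W' ~> W) :
  prod_aext f ∘ prod_map w (idm (T X)) = prod_aext (f ∘ prod_map w (idm X)).
Proof.
unfold prod_aext; rewrite pair_comp, !aext_nat, !comp_assoc; reflexivity.
Qed.

Lemma prod_aext_η (W X : C) (f : W × X ~> Z1 × Z2) :
  prod_aext f ∘ prod_map (idm W) (η X) = f.
Proof.
unfold prod_aext; rewrite pair_comp, !aext_η; symmetry; apply pair_unique.
Qed.

Lemma prod_aext_assoc (W W' X Y : C)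
  (f : W × X ~> T Y) (g : W' × Y ~> Z1 × Z2) :
  prod_aext (prod_aext g ∘ prod_map (idm W') f ∘ assoc)
  = prod_aext g ∘ prod_map (idm W') (bind f) ∘ assoc.
Proof.
unfold prod_aext; rewrite !pair_comp, pair_π1, pair_π2, !aext_assoc.
reflexivity.
Qed.

Definition prod_algebra : algebra T :=
  {| carrier := Z1 × Z2;
     aext := @prod_aext;
     aext_mono := prod_aext_mono;
     aext_nat := prod_aext_nat;
     aext_η := prod_aext_η;
     aext_assoc := prod_aext_assoc |}.

End ProductAlgebra.

Section PowerAlgebra.
Context {C : cartesian_closed} {T : strong_monad C} (Y : C) (Z : algebra T).

Definition power_aext {W X : C} (f : W × X ~> Y ⇒ Z) : W × T X ~> Y ⇒ Z :=
  curry (aext Z (uncurry f ∘ braid) ∘ braid).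

Lemma power_aext_mono (W X : C) (f f' : W × X ~> Y ⇒ Z) :
  f ⊑ f' -> power_aext f ⊑ power_aext f'.
Proof.
intro le_f; apply curry_mono, comp_mono; [|apply le_refl].
apply aext_mono, comp_mono; [|apply le_refl].
apply uncurry_mono; exact le_f.
Qed.

Lemma power_aext_nat (W W' X : C) (f : W × X ~> Y ⇒ Z) (w : W' ~> W) :
  power_aext f ∘ prod_map w (idm (T X)) = power_aext (f ∘ prod_map w (idm X)).
Proof.
unfold power_aext; rewrite <- curry_nat, uncurry_nat; f_equal.
transitivity (aext Z (uncurry f ∘ braid)
  ∘ prod_map (prod_map w (idm Y)) (idm (T X)) ∘ braid).
- cat_norm; reflexivity.
- rewrite aext_nat; do 2 f_equal; cat_norm; reflexivity.
Qed.

Lemma power_aext_η (W X : C) (f : W × X ~> Y ⇒ Z) :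
  power_aext f ∘ prod_map (idm W) (η X) = f.
Proof.
unfold power_aext; rewrite <- curry_nat.
rewrite <- (uncurryK f) at 2; f_equal.
transitivity (aext Z (uncurry f ∘ braid)
  ∘ prod_map (idm (W × Y)) (η X) ∘ braid).
- cat_norm; reflexivity.
- rewrite aext_η; cat_norm; reflexivity.
Qed.

Lemma power_aext_assoc (W W' X X' : C)
  (f : W × X ~> T X') (g : W' × X' ~> Y ⇒ Z) :
  power_aext (power_aext g ∘ prod_map (idm W') f ∘ assoc)
  = power_aext g ∘ prod_map (idm W') (bind f) ∘ assoc.
Proof.
unfold power_aext.
rewrite <- (comp_assoc (curry _) _ assoc), <- (comp_assoc (curry _) _ assoc).
rewrite <- (curry_nat _ (prod_map (idm W') f ∘ assoc)).
rewrite <- (curry_nat _ (prod_map (idm W') (bind f) ∘ assoc)), curryK.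
f_equal.
set (G := uncurry g ∘ braid).
transitivity (aext Z (aext Z G ∘ prod_map (idm (W' × Y)) f ∘ assoc
    ∘ prod_map braid (idm X)) ∘ braid).
- do 2 f_equal; cat_norm; reflexivity.
- rewrite <- aext_nat, aext_assoc; cat_norm; reflexivity.
Qed.

Definition power_algebra : algebra T :=
  {| carrier := Y ⇒ Z;
     aext := @power_aext;
     aext_mono := power_aext_mono;
     aext_nat := power_aext_nat;
     aext_η := power_aext_η;
     aext_assoc := power_aext_assoc |}.

End PowerAlgebra.

Record cbpv_model := {
  model_ccc :> cartesian_closed;
  two : coproduct (one (c := model_ccc)) one;
  mon : strong_monad model_ccc }.

Arguments two {c}.
Arguments mon {c}.

Section SelfCoproduct.
Context {M : cbpv_model}.

(* [W + W] is realised by [W × 2]; the copairing is obtained by transposition *)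
Definition self_copair {W Z : M} (f g : W ~> Z) : W × two ~> Z :=
  uncurry (copair (curry (f ∘ π2 (X := one))) (curry (g ∘ π2 (X := one))))
  ∘ swap.

Definition self_inj1 {W : M} : W ~> W × two := ⟨idm W, inj1 ∘ bang W⟩.
Definition self_inj2 {W : M} : W ~> W × two := ⟨idm W, inj2 ∘ bang W⟩.

Lemma uncurry_const {W Z : M} (f : W ~> Z) (k : two ~> W ⇒ Z) (i : one ~> two) :
  k ∘ i = curry (f ∘ π2) -> uncurry k ∘ swap ∘ ⟨idm W, i ∘ bang W⟩ = f.
Proof.
intro eq_k.
transitivity (uncurry (k ∘ i) ∘ ⟨bang W, idm W⟩).
- rewrite uncurry_nat; cat_norm; reflexivity.
- rewrite eq_k, curryK; cat_norm; reflexivity.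
Qed.

Lemma self_copair_inj1 (W Z : M) (f g : W ~> Z) :
  self_copair f g ∘ self_inj1 = f.
Proof. apply uncurry_const, copair_inj1. Qed.

Lemma self_copair_inj2 (W Z : M) (f g : W ~> Z) :
  self_copair f g ∘ self_inj2 = g.
Proof. apply uncurry_const, copair_inj2. Qed.

Lemma self_copair_unique (W Z : M) (h : W × two ~> Z) :
  h = self_copair (h ∘ self_inj1) (h ∘ self_inj2).
Proof.
unfold self_copair.
assert (eq_h : forall i : one ~> two,
  curry (h ∘ ⟨idm W, i ∘ bang W⟩ ∘ π2) = curry (h ∘ swap) ∘ i).
{ intro i; rewrite <- curry_nat; f_equal; cat_norm.
  rewrite (bang_unique (bang W ∘ π2)), <- (bang_unique π1); reflexivity. }
unfold self_inj1, self_inj2; rewrite !eq_h, <- copair_unique, curryK.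
cat_norm; reflexivity.
Qed.

Lemma self_copair_mono (W Z : M) (f f' g g' : W ~> Z) :
  f ⊑ f' -> g ⊑ g' -> self_copair f g ⊑ self_copair f' g'.
Proof.
intros le_f le_g; apply comp_mono; [|apply le_refl].
apply uncurry_mono, copair_mono; apply curry_mono;
  (apply comp_mono; [assumption|apply le_refl]).
Qed.

Definition self_coproduct (W : M) : coproduct W W :=
  {| cop_ob := W × two;
     inj1 := self_inj1;
     inj2 := self_inj2;
     copair := @self_copair W;
     copair_inj1 := @self_copair_inj1 W;
     copair_inj2 := @self_copair_inj2 W;
     copair_unique := @self_copair_unique W;
     copair_mono := @self_copair_mono W |}.

(* the canonical map [W + W ~> W × 2]; [dist], its inverse, is defined for any
   choice [S] of the coproduct [W + W] *)
Definition dist_inv {W : M} (S : coproduct W W) : S ~> W × two :=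
  copair ⟨idm W, inj1 ∘ bang W⟩ ⟨idm W, inj2 ∘ bang W⟩.

Definition dist {W : M} (S : coproduct W W) : W × two ~> S :=
  uncurry (copair (curry (inj1 ∘ π2)) (curry (inj2 ∘ π2))) ∘ swap.

Lemma distK (W : M) (S : coproduct W W) : dist_inv S ∘ dist S = idm (W × two).
Proof.
rewrite (self_copair_unique (dist_inv S ∘ dist S)).
rewrite (self_copair_unique (idm (W × two))), !comp_idl.
change (dist S) with (self_copair (inj1 (c := S)) inj2).
rewrite <- !comp_assoc, self_copair_inj1, self_copair_inj2.
unfold dist_inv; rewrite copair_inj1, copair_inj2; reflexivity.
Qed.

Lemma dist_invK (W : M) (S : coproduct W W) : dist S ∘ dist_inv S = idm S.
Proof.
rewrite (copair_unique (dist S ∘ dist_inv S)), (copair_unique (idm S)).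
rewrite <- !comp_assoc, !comp_idl; unfold dist_inv.
rewrite copair_inj1, copair_inj2.
change (dist S) with (self_copair (inj1 (c := S)) inj2).
change ⟨idm W, inj1 ∘ bang W⟩ with (@self_inj1 W).
change ⟨idm W, inj2 ∘ bang W⟩ with (@self_inj2 W).
rewrite self_copair_inj1, self_copair_inj2; reflexivity.
Qed.

(* [[f, g] ∘ dist_W] *)
Definition two_case {W Z : M} (f g : W ~> Z) : W × two ~> Z :=
  copair (c := self_coproduct W) f g ∘ dist (self_coproduct W).

End SelfCoproduct.

Inductive ty : Type :=
| ty_unit | ty_bool | ty_prod (τ1 τ2 : ty) | ty_fun (τ τ' : ty).

(* innermost variable first: [τ :: Γ] is the context Γ, x : τ *)
Definition ctx : Type := list ty.

Inductive var : ctx -> ty -> Type :=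
| var_z : forall Γ τ, var (τ :: Γ) τ
| var_s : forall Γ σ τ, var Γ τ -> var (σ :: Γ) τ.

(* intrinsically typed: [expr Γ τ] consists of the e with Γ ⊢ e : τ *)
Inductive expr (Γ : ctx) : ty -> Type :=
| e_var : forall τ, var Γ τ -> expr Γ τ
| e_unit : expr Γ ty_unit
| e_pair : forall τ1 τ2, expr Γ τ1 -> expr Γ τ2 -> expr Γ (ty_prod τ1 τ2)
| e_fst : forall τ1 τ2, expr Γ (ty_prod τ1 τ2) -> expr Γ τ1
| e_snd : forall τ1 τ2, expr Γ (ty_prod τ1 τ2) -> expr Γ τ2
| e_true : expr Γ ty_bool
| e_false : expr Γ ty_bool
| e_if : forall τ, expr Γ ty_bool -> expr Γ τ -> expr Γ τ -> expr Γ τ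
| e_lam : forall τ τ', expr (τ :: Γ) τ' -> expr Γ (ty_fun τ τ')
| e_app : forall τ τ', expr Γ (ty_fun τ τ') -> expr Γ τ -> expr Γ τ'.

Section Semantics.
Context {M : cbpv_model}.
Notation T := (@mon M).

Fixpoint cbv_ty (τ : ty) : M :=
  match τ with
  | ty_unit => one
  | ty_bool => two
  | ty_prod τ1 τ2 => cbv_ty τ1 × cbv_ty τ2
  | ty_fun τ τ' => cbv_ty τ ⇒ T (cbv_ty τ')
  end.

Fixpoint cbv_ctx (Γ : ctx) : M :=
  match Γ with
  | [] => one
  | τ :: Γ => cbv_ctx Γ × cbv_ty τ
  end.

Fixpoint cbv_var {Γ τ} (x : var Γ τ) : cbv_ctx Γ ~> cbv_ty τ :=
  match x with
  | var_z _ _ => π2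
  | var_s _ x => cbv_var x ∘ π1
  end.

Fixpoint cbv_sem {Γ τ} (e : expr Γ τ) : cbv_ctx Γ ~> T (cbv_ty τ) :=
  match e in expr _ τ return cbv_ctx Γ ~> T (cbv_ty τ) with
  | e_var x => η _ ∘ cbv_var x
  | e_unit _ => η one ∘ bang _
  | e_pair e1 e2 => ⟪cbv_sem e1, cbv_sem e2⟫
  | @e_fst _ τ1 τ2 e => fmap (π1 (X := cbv_ty τ1) (Y := cbv_ty τ2)) ∘ cbv_sem e
  | @e_snd _ τ1 τ2 e => fmap (π2 (X := cbv_ty τ1) (Y := cbv_ty τ2)) ∘ cbv_sem e
  | e_true _ => η two ∘ inj1 ∘ bang _
  | e_false _ => η two ∘ inj2 ∘ bang _
  | e_if e0 e1 e2 => bind (two_case (cbv_sem e1) (cbv_sem e2)) ∘ ⟨idm _, cbv_sem e0⟩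
  | e_lam e => η _ ∘ curry (W := cbv_ctx Γ) (cbv_sem e)
  | @e_app _ τ τ' e e' =>
      lift (ev (X := cbv_ty τ) (Y := T (cbv_ty τ'))) ∘ ⟪cbv_sem e, cbv_sem e'⟫
  end.

Fixpoint cbn_ty (τ : ty) : algebra T :=
  match τ with
  | ty_unit => free_algebra T one
  | ty_bool => free_algebra T two
  | ty_prod τ1 τ2 => prod_algebra (cbn_ty τ1) (cbn_ty τ2)
  | ty_fun τ τ' => power_algebra (cbn_ty τ) (cbn_ty τ')
  end.

Fixpoint cbn_ctx (Γ : ctx) : M :=
  match Γ with
  | [] => one
  | τ :: Γ => cbn_ctx Γ × cbn_ty τ
  end.

Fixpoint cbn_var {Γ τ} (x : var Γ τ) : cbn_ctx Γ ~> cbn_ty τ :=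
  match x with
  | var_z _ _ => π2
  | var_s _ x => cbn_var x ∘ π1
  end.

Fixpoint cbn_sem {Γ τ} (e : expr Γ τ) : cbn_ctx Γ ~> cbn_ty τ :=
  match e in expr _ τ return cbn_ctx Γ ~> cbn_ty τ with
  | e_var x => cbn_var x
  | e_unit _ => η one ∘ bang _
  | e_pair e1 e2 => ⟨cbn_sem e1, cbn_sem e2⟩
  | @e_fst _ τ1 τ2 e => π1 (X := cbn_ty τ1) (Y := cbn_ty τ2) ∘ cbn_sem e
  | @e_snd _ τ1 τ2 e => π2 (X := cbn_ty τ1) (Y := cbn_ty τ2) ∘ cbn_sem e
  | e_true _ => η two ∘ inj1 ∘ bang _
  | e_false _ => η two ∘ inj2 ∘ bang _
  | @e_if _ τ e0 e1 e2 =>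
      aext (cbn_ty τ) (two_case (cbn_sem e1) (cbn_sem e2)) ∘ ⟨idm _, cbn_sem e0⟩
  | e_lam e => curry (W := cbn_ctx Γ) (cbn_sem e)
  | @e_app _ τ τ' e e' =>
      ev (X := cbn_ty τ) (Y := cbn_ty τ') ∘ ⟨cbn_sem e, cbn_sem e'⟩
  end.

Fixpoint rel (τ : ty) (W : M) :
  (W ~> T (cbv_ty τ)) -> (W ~> cbn_ty τ) -> Prop :=
  match τ return (W ~> T (cbv_ty τ)) -> (W ~> cbn_ty τ) -> Prop with
  | ty_unit => fun fv fn => fv ⊑ fn
  | ty_bool => fun fv fn => fv ⊑ fn
  | ty_prod τ1 τ2 => fun fv fn =>
      rel (fmap (π1 (X := cbv_ty τ1) (Y := cbv_ty τ2)) ∘ fv)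
          (π1 (X := cbn_ty τ1) (Y := cbn_ty τ2) ∘ fn)
      /\ rel (fmap (π2 (X := cbv_ty τ1) (Y := cbv_ty τ2)) ∘ fv)
             (π2 (X := cbn_ty τ1) (Y := cbn_ty τ2) ∘ fn)
  | ty_fun τ τ' => fun fv fn =>
      forall (W' : M) (w : W' ~> W) (gv : W' ~> T (cbv_ty τ))
        (gn : W' ~> cbn_ty τ),
        rel gv gn -> rel (lift (ev (X := cbv_ty τ) (Y := T (cbv_ty τ'))) ∘ ⟪fv ∘ w, gv⟫)
            (ev (X := cbn_ty τ) (Y := cbn_ty τ') ∘ ⟨fn ∘ w, gn⟩)
  end.

Fixpoint cbv_tuple (W : M) (Γ : ctx) :
  (forall τ, var Γ τ -> W ~> T (cbv_ty τ)) -> W ~> T (cbv_ctx Γ) :=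
  match Γ return (forall τ, var Γ τ -> W ~> T (cbv_ty τ)) ->
                 W ~> T (cbv_ctx Γ) with
  | [] => fun _ => η one ∘ bang W
  | σ :: Γ => fun f =>
      ⟪cbv_tuple (fun τ x => f τ (var_s σ x)), f σ (var_z Γ σ)⟫
  end.

Fixpoint cbn_tuple (W : M) (Γ : ctx) :
  (forall τ, var Γ τ -> W ~> cbn_ty τ) -> W ~> cbn_ctx Γ :=
  match Γ return (forall τ, var Γ τ -> W ~> cbn_ty τ) -> W ~> cbn_ctx Γ with
  | [] => fun _ => bang W
  | σ :: Γ => fun f =>
      ⟨cbn_tuple (fun τ x => f τ (var_s σ x)), f σ (var_z Γ σ)⟩
  end.

Definition open_rel {Γ : ctx} {τ : ty}
  (gv : cbv_ctx Γ ~> T (cbv_ty τ)) (gn : cbn_ctx Γ ~> cbn_ty τ) : Prop :=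
  forall (W : M) (fv : forall σ, var Γ σ -> W ~> T (cbv_ty σ))
    (fn : forall σ, var Γ σ -> W ~> cbn_ty σ),
    (forall σ (x : var Γ σ), rel (fv σ x) (fn σ x)) ->
    rel (lift gv ∘ cbv_tuple fv) (gn ∘ cbn_tuple fn).

End Semantics.

Notation "gv ⋉ gn" := (open_rel gv gn)
  (at level 70, no associativity) : cat_scope.

(* Main.v *)
(* By induction on [e].  The relation is stable under reindexing, under the order
   (downwards on the left, upwards on the right) and under algebra extension;
   the last holds because application evaluates the function first.  Both
   semantics agree on abstraction and projections.  Everywhere else the
   call-by-value side runs the tuple of arguments once, whereas call-by-name
   runs it at each use: discardability drops an unused run, copyability creates
   a second one, and centrality moves it past the computations that separate
   the uses. *)
Require Import Defs.
From Stdlib Require Import List.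
Import ListNotations.

Set Implicit Arguments.
Unset Strict Implicit.
Unset Printing Implicit Defensive.

(** * Terminal maps and one-sided monotonicity of composition *)

Lemma bang_comp {C : cartesian} {X Y : C} (f : X ~> Y) : bang Y ∘ f = bang X.
Proof. apply bang_unique. Qed.

Lemma comp_monol {C : poset_category} {X Y Z : C} (g g' : Y ~> Z) (f : X ~> Y) :
  g ⊑ g' -> g ∘ f ⊑ g' ∘ f.
Proof. intro le_g; apply comp_mono; [exact le_g|apply le_refl]. Qed.

Lemma comp_monor {C : poset_category} {X Y Z : C} (g : Y ~> Z) (f f' : X ~> Y) :
  f ⊑ f' -> g ∘ f ⊑ g ∘ f'.
Proof. intro le_f; apply comp_mono; [apply le_refl|exact le_f]. Qed.

(** * Let-binding into an algebra *)

Section AlgebraLet.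
Context {C : cartesian} {T : strong_monad C} (Z : algebra T).

Definition alet {W X : C} (f : W ~> T X) (g : W × X ~> Z) : W ~> Z :=
  aext Z g ∘ ⟨idm W, f⟩.

Lemma alet_mono (W X : C) (f f' : W ~> T X) (g g' : W × X ~> Z) :
  f ⊑ f' -> g ⊑ g' -> alet f g ⊑ alet f' g'.
Proof.
intros le_f le_g; apply comp_mono; [apply aext_mono; exact le_g|].
apply pair_mono; [apply le_refl|exact le_f].
Qed.

Lemma alet_comp (W W' X : C) (f : W ~> T X) (g : W × X ~> Z) (w : W' ~> W) :
  alet f g ∘ w = alet (f ∘ w) (g ∘ ⟨w ∘ π1, π2⟩).
Proof.
transitivity (aext Z g ∘ prod_map w (idm (T X)) ∘ ⟨idm W', f ∘ w⟩).
- unfold alet; cat_norm; reflexivity.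
- rewrite aext_nat; unfold alet; cat_norm; reflexivity.
Qed.

Lemma alet_ret (W X : C) (x : W ~> X) (g : W × X ~> Z) :
  alet (η X ∘ x) g = g ∘ ⟨idm W, x⟩.
Proof.
transitivity (aext Z g ∘ prod_map (idm W) (η X) ∘ ⟨idm W, x⟩).
- unfold alet; cat_norm; reflexivity.
- rewrite aext_η; reflexivity.
Qed.

End AlgebraLet.

(* [let x ← f in g], where [g] keeps the context [W]; [alet] is the same with an
   arbitrary algebra as target. *)
Definition let_ {C : cartesian} {T : strong_monad C} {W X Y : C}
  (f : W ~> T X) (g : W × X ~> T Y) : W ~> T Y := bind g ∘ ⟨idm W, f⟩.

(** * The monad laws in let form *)

Section Let.
Context {C : cartesian} {T : strong_monad C}.

Lemma let_mono (W X Y : C) (f f' : W ~> T X) (g g' : W × X ~> T Y) :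
  f ⊑ f' -> g ⊑ g' -> let_ f g ⊑ let_ f' g'.
Proof. exact (@alet_mono C T (free_algebra T Y) W X f f' g g'). Qed.

Lemma let_comp (W W' X Y : C) (f : W ~> T X) (g : W × X ~> T Y) (w : W' ~> W) :
  let_ f g ∘ w = let_ (f ∘ w) (g ∘ ⟨w ∘ π1, π2⟩).
Proof. exact (@alet_comp C T (free_algebra T Y) W W' X f g w). Qed.

Lemma let_ret (W X Y : C) (x : W ~> X) (g : W × X ~> T Y) :
  let_ (η X ∘ x) g = g ∘ ⟨idm W, x⟩.
Proof. exact (@alet_ret C T (free_algebra T Y) W X x g). Qed.

(** Trades [bind] for [let_], so that [seqL] and [seqR] unfold into nested lets. *)
Lemma bind_let (W X Y : C) (g : W × X ~> T Y) :
  bind g = let_ π2 (g ∘ ⟨π1 ∘ π1, π2⟩).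
Proof.
transitivity (let_ π2 (g ∘ ⟨π1 ∘ π1, π2⟩) ∘ idm (W × T X)).
2: apply comp_idr.
unfold let_.
replace ⟨π1 ∘ π1, π2⟩ with (prod_map (Y := X) (π1 (X := W) (Y := T X)) (idm X)).
- rewrite <- bind_nat; cat_norm; reflexivity.
- cat_norm; reflexivity.
Qed.

Lemma let_η (W X : C) (f : W ~> T X) : let_ f (η X ∘ π2) = f.
Proof.
transitivity (bind (η X ∘ π2 (X := one)) ∘ prod_map (bang W) (idm (T X))
  ∘ ⟨idm W, f⟩).
- rewrite bind_nat; unfold let_; cat_norm; reflexivity.
- rewrite bind_ret; cat_norm; reflexivity.
Qed.

(** [bind_assoc] keeps the contexts of the two extensions apart; restricting it along the diagonal
    of [W] lets both share one context. *)
Lemma let_let (W X Y Z : C) (f : W ~> T X) (g : W × X ~> T Y)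
  (h : W × Y ~> T Z) :
  let_ (let_ f g) h = let_ f (let_ g (h ∘ ⟨π1 ∘ π1, π2⟩)).
Proof.
transitivity (bind h ∘ prod_map (idm W) (bind g) ∘ assoc
  ∘ ⟨⟨idm W, idm W⟩, f⟩).
{ unfold let_; cat_norm; reflexivity. }
rewrite <- bind_assoc.
transitivity (bind (bind h ∘ prod_map (idm W) g ∘ assoc)
  ∘ prod_map ⟨idm W, idm W⟩ (idm (T X)) ∘ ⟨idm W, f⟩).
{ cat_norm; reflexivity. }
rewrite bind_nat; unfold let_ at 1; do 2 f_equal.
rewrite (bind_let h).
unfold prod_map, assoc; rewrite !let_comp; cat_norm; reflexivity.
Qed.

Lemma lift_let (X Y : C) (g : X ~> T Y) : lift g = let_ (idm (T X)) (g ∘ π2).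
Proof.
unfold lift; rewrite bind_let, let_comp; cat_norm; reflexivity.
Qed.

Lemma pairL_let (W X1 X2 : C) (f : W ~> T X1) (g : W ~> T X2) :
  ⟪f, g⟫ = let_ f (let_ (g ∘ π1) (η (X1 × X2) ∘ ⟨π2 ∘ π1, π2⟩)).
Proof.
unfold pairL, seqL, bindl; rewrite !bind_let.
repeat progress (rewrite ?let_comp; cat_norm); reflexivity.
Qed.

Lemma seqR_let (W X1 X2 : C) (f : W ~> T X1) (g : W ~> T X2) :
  seqR ∘ ⟨f, g⟩ = let_ g (let_ (f ∘ π1) (η (X1 × X2) ∘ ⟨π2, π2 ∘ π1⟩)).
Proof.
unfold seqR, bindl; rewrite !bind_let.
repeat progress (rewrite ?let_comp; cat_norm); reflexivity.
Qed.

End Let.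

(** Normal form: lets nested to the right, reindexings pushed inwards, returned values
    substituted. *)
Ltac let_norm :=
  unfold fmap; rewrite ?lift_let;
  repeat progress
    (rewrite ?pairL_let, ?let_comp, ?let_ret, ?let_η, ?let_let,
       ?bang_comp; cat_norm).

Lemma pairL_comp {C : cartesian} {T : strong_monad C} {V W X Y : C}
  (f : W ~> T X) (g : W ~> T Y) (w : V ~> W) : ⟪f, g⟫ ∘ w = ⟪f ∘ w, g ∘ w⟫.
Proof. unfold pairL; rewrite <- comp_assoc, pair_comp; reflexivity. Qed.

Lemma fmap_lift {C : cartesian} {T : strong_monad C} {X Y Z : C}
  (g : X ~> T Y) (h : Y ~> Z) :
  fmap (T := T) h ∘ lift g = lift (fmap h ∘ g).
Proof. let_norm; reflexivity. Qed.

(** * Discarding, copying and exchanging computations *)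

Section Lax.
Context {C : cartesian} {T : strong_monad C}.

(** A body that ignores the result cannot tell [f] from [fmap (bang X) ∘ f], to which discardability
    applies directly. *)
Lemma let_discard (W X Y : C) (f : W ~> T X) (g : W ~> T Y) :
  lax_discardable f -> let_ f (g ∘ π1) ⊑ g.
Proof.
intro disc.
replace (let_ f (g ∘ π1)) with (let_ (fmap (bang X) ∘ f) (g ∘ π1))
  by (let_norm; reflexivity).
replace g with (let_ (η one ∘ bang W) (g ∘ π1)) at 2
  by (let_norm; reflexivity).
apply let_mono; [exact disc|apply le_refl].
Qed.

Lemma let_copy (W X Y : C) (f : W ~> T X) (h : (W × X) × X ~> T Y) :
  lax_copyable f ->
  let_ f (h ∘ ⟨idm (W × X), π2⟩) ⊑ let_ f (let_ (f ∘ π1) h).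
Proof.
intro copy.
(* [k] is [h] with the two results gathered into one pair: both sides become lets over [k] and
   differ only in the bound computation. *)
pose (k := h ∘ ⟨⟨π1, π1 ∘ π2⟩, π2 ∘ π2⟩).
replace (let_ f (h ∘ ⟨idm _, π2⟩)) with (let_ (fmap ⟨idm X, idm X⟩ ∘ f) k)
  by (unfold k; let_norm; reflexivity).
replace (let_ f (let_ (f ∘ π1) h)) with (let_ ⟪f, f⟫ k)
  by (unfold k; let_norm; reflexivity).
apply let_mono; [exact copy|apply le_refl].
Qed.

Lemma let_central (W X Y Z : C) (f : W ~> T X) (g : W ~> T Y)
  (h : (W × X) × Y ~> T Z) :
  lax_central f ->
  let_ f (let_ (g ∘ π1) h) ⊑ let_ g (let_ (f ∘ π1) (h ∘ braid)).
Proof.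
intro central.
pose (k := h ∘ ⟨⟨π1, π1 ∘ π2⟩, π2 ∘ π2⟩).
replace (let_ f (let_ (g ∘ π1) h)) with (let_ ⟪f, g⟫ k)
  by (unfold k; let_norm; reflexivity).
replace (let_ g (let_ (f ∘ π1) (h ∘ braid))) with (let_ (seqR ∘ ⟨f, g⟩) k)
  by (unfold k; rewrite seqR_let; let_norm; reflexivity).
apply let_mono; [|apply le_refl].
(* Centrality is stated for a generic second computation; precomposing with [⟨idm W, g⟩] specialises
   it to [g]. *)
generalize (comp_monol ⟨idm W, g⟩ (central Y)); unfold pairL; cat_norm.
intro le_seq; exact le_seq.
Qed.

(* [x ← t; a ← e x; k a x] is below [x ← t; a ← e x; x' ← t; k a x']: copy [t],
   then move the second copy past [e]. *)
Lemma let_duplicate (W X A Y : C) (t : W ~> T X) (e : X ~> T A)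
  (k : A × X ~> T Y) :
  lax_copyable t -> lax_central (t ∘ π1 (Y := X)) ->
  let_ t (let_ (e ∘ π2) (k ∘ ⟨π2, π2 ∘ π1⟩))
  ⊑ let_ (lift e ∘ t) (let_ (t ∘ π1) (k ∘ ⟨π2 ∘ π1, π2⟩)).
Proof.
intros copy central.
apply le_trans with (let_ t (let_ (t ∘ π1)
  (let_ (e ∘ π2 ∘ π1) (k ∘ ⟨π2, π2 ∘ π1⟩)))).
- eapply le_trans; [|apply let_copy; exact copy].
  let_norm; apply le_refl.
- eapply le_trans.
  + apply let_mono; [apply le_refl|].
    (* The exchange happens under the first binder, hence the weakened [t ∘ π1] in the
       hypothesis. *)
    apply let_central; exact central.
  + let_norm; apply le_refl.
Qed.

Lemma lift_const (W X Y : C) (f : W ~> T X) (g : one ~> T Y) :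
  lax_discardable f -> lift (g ∘ bang X) ∘ f ⊑ g ∘ bang W.
Proof.
intro disc.
replace (lift (g ∘ bang X) ∘ f) with (let_ f ((g ∘ bang W) ∘ π1))
  by (let_norm; reflexivity).
apply let_discard; exact disc.
Qed.

(** [g] runs after [f], in the context [W × X], so it is [g ∘ π1] that gets discarded. *)
Lemma fmap_π1_pairL (W X Y : C) (f : W ~> T X) (g : W ~> T Y) :
  lax_discardable (g ∘ π1 (Y := X)) -> fmap π1 ∘ ⟪f, g⟫ ⊑ f.
Proof.
intro disc.
replace (fmap π1 ∘ ⟪f, g⟫) with (let_ f (let_ (g ∘ π1) (η X ∘ π2 ∘ π1)))
  by (let_norm; reflexivity).
rewrite <- (let_η f) at 2.
apply let_mono; [apply le_refl|apply let_discard; exact disc].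
Qed.

Lemma fmap_π2_pairL (W X Y : C) (f : W ~> T X) (g : W ~> T Y) :
  lax_discardable f -> fmap π2 ∘ ⟪f, g⟫ ⊑ g.
Proof.
intro disc.
replace (fmap π2 ∘ ⟪f, g⟫) with (let_ f (g ∘ π1)) by (let_norm; reflexivity).
apply let_discard; exact disc.
Qed.

End Lax.

(** * Evaluation and the power algebra *)

Lemma ev_pair {C : cartesian_closed} {W X Y : C} (g : W ~> X ⇒ Y) (f : W ~> X) :
  ev ∘ ⟨g, f⟩ = uncurry g ∘ ⟨idm W, f⟩.
Proof.
rewrite <- (comp_idl g) at 2.
rewrite uncurry_nat; unfold ev; cat_norm; reflexivity.
Qed.

Lemma ev_curry {C : cartesian_closed} {V W X Y : C} (g : W × X ~> Y)
  (w : V ~> W) (f : V ~> X) : ev ∘ ⟨curry g ∘ w, f⟩ = g ∘ ⟨w, f⟩.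
Proof. rewrite <- curry_nat, ev_pair, curryK; cat_norm; reflexivity. Qed.

(** The power algebra extends pointwise, with the argument as an extra parameter; naturality in that
    parameter instantiates it at [h]. Hence a let in function position moves out of the
    application. *)
Lemma ev_alet {C : cartesian_closed} {T : strong_monad C} (Y : C)
  (Z : algebra T) (V W X : C) (f : W ~> T X) (g : W × X ~> Y ⇒ Z) (w : V ~> W)
  (h : V ~> Y) :
  ev ∘ ⟨alet (Z := power_algebra Y Z) f g ∘ w, h⟩
  = alet (Z := Z) (f ∘ w) (ev ∘ ⟨g ∘ ⟨w ∘ π1, π2⟩, h ∘ π1⟩).
Proof.
unfold alet at 1; simpl; unfold power_aext.
rewrite <- comp_assoc, ev_curry.
transitivity (aext Z (uncurry g ∘ braid)
  ∘ prod_map ⟨w, h⟩ (idm (T X)) ∘ ⟨idm V, f ∘ w⟩).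
- cat_norm; reflexivity.
- rewrite aext_nat; unfold alet.
  do 2 f_equal; rewrite ev_pair, uncurry_nat.
  cat_norm; reflexivity.
Qed.

(** * Case analysis on [two] *)

Section Relation.
Context {M : cbpv_model}.

(** The chosen coproduct [W + W] is [W × two] itself, so [dist] is the copairing of its own
    injections, that is, the identity. *)
Lemma two_case_eq (W Z : M) (f g : W ~> Z) : two_case f g = self_copair f g.
Proof.
unfold two_case; symmetry.
rewrite (self_copair_unique (_ ∘ dist _)).
change (dist (self_coproduct W)) with
  (self_copair (self_inj1 (W := W)) self_inj2).
rewrite <- !comp_assoc, self_copair_inj1, self_copair_inj2.
simpl; rewrite self_copair_inj1, self_copair_inj2; reflexivity.
Qed.

Lemma two_case_mono (W Z : M) (f f' g g' : W ~> Z) :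
  f ⊑ f' -> g ⊑ g' -> two_case f g ⊑ two_case f' g'.
Proof. intros; rewrite !two_case_eq; apply self_copair_mono; assumption. Qed.

Lemma two_case_unique (W Z : M) (h : W × two ~> Z) (f g : W ~> Z) :
  h ∘ ⟨idm W, inj1 ∘ bang W⟩ = f -> h ∘ ⟨idm W, inj2 ∘ bang W⟩ = g ->
  h = two_case f g.
Proof.
intros <- <-; rewrite two_case_eq; apply self_copair_unique.
Qed.

Lemma two_case_inj1 (W Z : M) (f g : W ~> Z) :
  two_case f g ∘ ⟨idm W, inj1 ∘ bang W⟩ = f.
Proof. rewrite two_case_eq; apply self_copair_inj1. Qed.

Lemma two_case_inj2 (W Z : M) (f g : W ~> Z) :
  two_case f g ∘ ⟨idm W, inj2 ∘ bang W⟩ = g.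
Proof. rewrite two_case_eq; apply self_copair_inj2. Qed.

Lemma two_case_post (W Y Z : M) (f g : W ~> Y) (h : Y ~> Z) :
  h ∘ two_case f g = two_case (h ∘ f) (h ∘ g).
Proof.
apply two_case_unique; rewrite <- comp_assoc;
  rewrite ?two_case_inj1, ?two_case_inj2; reflexivity.
Qed.

Lemma two_case_nat (W V Z : M) (f g : W ~> Z) (w : V ~> W) :
  two_case f g ∘ prod_map w (idm two) = two_case (f ∘ w) (g ∘ w).
Proof.
apply two_case_unique.
- rewrite <- (two_case_inj1 f g) at 2; cat_norm; rewrite bang_comp; reflexivity.
- rewrite <- (two_case_inj2 f g) at 2; cat_norm; rewrite bang_comp; reflexivity.
Qed.

Lemma two_case_pre (W V Z : M) (f g : W ~> Z) (w : V ~> W) (b : V ~> two) :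
  two_case f g ∘ ⟨w, b⟩ = two_case (f ∘ w) (g ∘ w) ∘ ⟨idm V, b⟩.
Proof. rewrite <- two_case_nat; cat_norm; reflexivity. Qed.

(** Moves a case split out of an argument of [op]; for [op] an application, this is the function
    case of [rel_two_case_at]. *)
Lemma two_case_args (V W Y Z : M) (op : V × Y ~> Z) (f g : W ~> Y)
  (w : V ~> W) (b : W ~> two) :
  two_case (op ∘ ⟨idm V, f ∘ w⟩) (op ∘ ⟨idm V, g ∘ w⟩) ∘ ⟨idm V, b ∘ w⟩
  = op ∘ ⟨idm V, two_case f g ∘ ⟨idm W, b⟩ ∘ w⟩.
Proof.
cat_norm; rewrite (two_case_pre f g).
transitivity (op ∘ ⟨π1, two_case (f ∘ w) (g ∘ w)⟩ ∘ ⟨idm V, b ∘ w⟩).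
2: cat_norm; reflexivity.
f_equal; symmetry; apply two_case_unique; rewrite <- comp_assoc, pair_comp;
  rewrite ?two_case_inj1, ?two_case_inj2, pair_π1; reflexivity.
Qed.

(** * Closure properties of the relation *)

Lemma rel_le (τ : ty) (W : M) (fv fv' : W ~> mon (cbv_ty τ))
  (fn fn' : W ~> cbn_ty τ) :
  fv' ⊑ fv -> fn ⊑ fn' -> rel fv fn -> rel fv' fn'.
Proof.
revert W fv fv' fn fn'; induction τ as [| |τ1 IH1 τ2 IH2|τ1 _ τ2 IH];
  simpl; intros W fv fv' fn fn' le_v le_n.
- intro r; exact (le_trans le_v (le_trans r le_n)).
- intro r; exact (le_trans le_v (le_trans r le_n)).
- intros [r1 r2]; split;
    [revert r1; apply IH1|revert r2; apply IH2]; apply comp_monor; assumption.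
- intros r W' w gv gn rg; generalize (r W' w gv gn rg).
  apply IH; apply comp_monor; [apply comp_monor|]; apply pair_mono;
    try apply le_refl; apply comp_monol; assumption.
Qed.

Lemma rel_comp (τ : ty) (W W' : M) (fv : W ~> mon (cbv_ty τ))
  (fn : W ~> cbn_ty τ) (w : W' ~> W) : rel fv fn -> rel (fv ∘ w) (fn ∘ w).
Proof.
revert W W' fv fn w; induction τ as [| |τ1 IH1 τ2 IH2|τ1 _ τ2 _];
  simpl; intros W W' fv fn w.
- apply comp_monol.
- apply comp_monol.
- intros [r1 r2]; rewrite !comp_assoc; split; [apply IH1|apply IH2]; assumption.
- intros r W'' w' gv gn rg; rewrite <- !comp_assoc; apply r; exact rg.
Qed.

Lemma rel_let (τ : ty) (W X : M) (f : W ~> mon X)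
  (gv : W × X ~> mon (cbv_ty τ)) (gn : W × X ~> cbn_ty τ) :
  rel gv gn -> rel (let_ f gv) (alet (Z := cbn_ty τ) f gn).
Proof.
revert W f gv gn; induction τ as [| |τ1 IH1 τ2 IH2|τ1 _ τ2 IH];
  simpl; intros W f gv gn.
- apply let_mono, le_refl.
- apply let_mono, le_refl.
- intros [r1 r2]; split.
  + replace (fmap π1 ∘ let_ f gv) with
      (let_ f (fmap (π1 (X := cbv_ty τ1) (Y := cbv_ty τ2)) ∘ gv))
      by (let_norm; reflexivity).
    replace (π1 ∘ _) with (alet (Z := cbn_ty τ1) f (π1 ∘ gn))
      by (unfold alet; simpl; unfold prod_aext; cat_norm; reflexivity).
    apply IH1; exact r1.
  + replace (fmap π2 ∘ let_ f gv) with
      (let_ f (fmap (π2 (X := cbv_ty τ1) (Y := cbv_ty τ2)) ∘ gv))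
      by (let_norm; reflexivity).
    replace (π2 ∘ _) with (alet (Z := cbn_ty τ2) f (π2 ∘ gn))
      by (unfold alet; simpl; unfold prod_aext; cat_norm; reflexivity).
    apply IH2; exact r2.
- intros r W' w hv hn rh.
  (* The bodies are related over [W × X], so the hypothesis is used in the world [W' × X], with the
     arguments weakened. Application evaluates the function first, so [f] comes out in front on both
     sides. *)
  pose proof (r _ ⟨w ∘ π1, π2⟩ _ _ (rel_comp (π1 (Y := X)) rh)) as r'.
  apply (IH _ (f ∘ w)) in r'.
  replace (ev ∘ _) with (alet (Z := cbn_ty τ2) (f ∘ w)
    (ev (X := cbn_ty τ1) (Y := cbn_ty τ2)
     ∘ ⟨gn ∘ ⟨w ∘ π1, π2⟩, hn ∘ π1 (Y := X)⟩))
    by (symmetry; apply ev_alet).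
  replace (lift _ ∘ _) with (let_ (f ∘ w)
    (lift ev ∘ ⟪gv ∘ ⟨w ∘ π1, π2⟩, hv ∘ π1 (Y := X)⟫))
    by (let_norm; reflexivity).
  exact r'.
Qed.

(** The explicit scrutinee [b] keeps the branches over [W]: in the function case a reindexing [w]
    then acts on the branches and on [b] separately. The generic case [b = π2] is recovered
    afterwards. *)
Lemma rel_two_case_at (τ : ty) (W : M) (fv gv : W ~> mon (cbv_ty τ))
  (fn gn : W ~> cbn_ty τ) (b : W ~> two) :
  rel fv fn -> rel gv gn ->
  rel (two_case fv gv ∘ ⟨idm W, b⟩) (two_case fn gn ∘ ⟨idm W, b⟩).
Proof.
revert W fv gv fn gn b; induction τ as [| |τ1 IH1 τ2 IH2|τ1 _ τ2 IH];
  simpl; intros W fv gv fn gn b.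
- intros; apply comp_monol, two_case_mono; assumption.
- intros; apply comp_monol, two_case_mono; assumption.
- intros [r1 r2] [s1 s2]; rewrite !comp_assoc, !two_case_post.
  split; [apply IH1|apply IH2]; assumption.
- intros r s W' w hv hn rh.
  generalize (IH W' _ _ _ _ (b ∘ w) (r W' w hv hn rh) (s W' w hv hn rh)).
  assert (op_v : forall a, lift (ev (X := cbv_ty τ1) (Y := mon (cbv_ty τ2)))
      ∘ ⟪a, hv⟫
    = lift (ev (X := cbv_ty τ1) (Y := mon (cbv_ty τ2))) ∘ ⟪π2, hv ∘ π1⟫
      ∘ ⟨idm W', a⟩)
    by (intro a; rewrite <- comp_assoc, pairL_comp; cat_norm; reflexivity).
  assert (op_n : forall a, ev (X := cbn_ty τ1) (Y := cbn_ty τ2) ∘ ⟨a, hn⟩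
    = ev (X := cbn_ty τ1) (Y := cbn_ty τ2) ∘ ⟨π2, hn ∘ π1⟩ ∘ ⟨idm W', a⟩)
    by (intro a; cat_norm; reflexivity).
  rewrite !op_v, !op_n, !two_case_args.
  exact (fun x => x).
Qed.

Lemma rel_two_case (τ : ty) (W : M) (fv gv : W ~> mon (cbv_ty τ))
  (fn gn : W ~> cbn_ty τ) :
  rel fv fn -> rel gv gn -> rel (two_case fv gv) (two_case fn gn).
Proof.
intros rf rg.
rewrite <- (comp_idr (two_case fv gv)), <- (comp_idr (two_case fn gn)).
rewrite <- pair_id, !(two_case_pre _ _ π1).
apply rel_two_case_at; apply rel_comp; assumption.
Qed.

End Relation.

(** The match returns a statement quantified over the motive [Q], which allows inversion on a
    nonempty context without any equality between contexts. It computes on constructors, so it also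
    serves to extend families of arguments. *)
Definition var_case {Γ : ctx} {τ : ty} (P : forall σ, var (τ :: Γ) σ -> Type)
  (pz : P τ (var_z Γ τ)) (ps : forall σ (x : var Γ σ), P σ (var_s τ x))
  (σ : ty) (x : var (τ :: Γ) σ) : P σ x :=
  match x as x in var Δ σ return
    match Δ return var Δ σ -> Type with
    | [] => fun _ => unit
    | ρ :: Δ => fun x => forall Q : (forall σ, var (ρ :: Δ) σ -> Type),
        Q ρ (var_z Δ ρ) -> (forall σ y, Q σ (var_s ρ y)) -> Q σ x
    end x
  with
  | var_z _ _ => fun _ qz _ => qz
  | var_s _ y => fun _ _ qs => qs _ y
  end P pz ps.

(** * Tuples of arguments and variable lookup *)

Section Substitution.
Context {M : cbpv_model}.

Lemma cbv_tuple_comp (W W' : M) (Γ : ctx)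
  (f : forall τ, var Γ τ -> W ~> mon (cbv_ty τ)) (w : W' ~> W) :
  cbv_tuple f ∘ w = cbv_tuple (fun τ x => f τ x ∘ w).
Proof.
induction Γ as [|σ Γ IH]; simpl.
- rewrite <- comp_assoc, bang_comp; reflexivity.
- rewrite pairL_comp, IH; reflexivity.
Qed.

Lemma cbn_tuple_comp (W W' : M) (Γ : ctx)
  (f : forall τ, var Γ τ -> W ~> cbn_ty τ) (w : W' ~> W) :
  cbn_tuple f ∘ w = cbn_tuple (fun τ x => f τ x ∘ w).
Proof.
induction Γ as [|σ Γ IH]; simpl.
- apply bang_comp.
- rewrite pair_comp, IH; reflexivity.
Qed.

Lemma cbn_var_tuple (W : M) (Γ : ctx) (τ : ty) (x : var Γ τ)
  (f : forall τ, var Γ τ -> W ~> cbn_ty τ) :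
  cbn_var x ∘ cbn_tuple f = f τ x.
Proof.
induction x as [Γ τ|Γ σ τ x IH]; simpl; cat_norm; [reflexivity|apply IH].
Qed.

(** Moves the second run of the arguments, placed after the scrutinee, into each branch. *)
Lemma let_two_case (W X Z : M) (t : W ~> mon X) (f g : X ~> mon Z) :
  let_ (t ∘ π1 (Y := two)) (two_case f g ∘ ⟨π2, π2 ∘ π1⟩)
  = two_case (lift f ∘ t) (lift g ∘ t).
Proof.
apply two_case_unique; let_norm.
- rewrite two_case_pre, two_case_inj1; reflexivity.
- rewrite two_case_pre, two_case_inj2; reflexivity.
Qed.

(** The tuple runs every argument while the variable keeps one; the others are discarded by
    recursion on the variable. *)
Lemma cbv_var_tuple (W : M) (Γ : ctx) (τ : ty) (x : var Γ τ)
  (f : forall τ, var Γ τ -> W ~> mon (cbv_ty τ))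
  (discardable : forall (X Y : M) (g : X ~> mon Y), lax_discardable g) :
  fmap (cbv_var x) ∘ cbv_tuple f ⊑ f τ x.
Proof.
induction x as [Γ τ|Γ σ τ x IH]; simpl.
- apply fmap_π2_pairL, discardable.
- eapply le_trans; [|exact (IH (fun τ x => f τ (var_s σ x)))].
  set (t := cbv_tuple (fun τ x => f τ (var_s σ x))).
  replace (fmap (cbv_var x ∘ π1) ∘ ⟪t, f σ (var_z Γ σ)⟫)
    with (fmap (cbv_var x) ∘ (fmap π1 ∘ ⟪t, f σ (var_z Γ σ)⟫))
    by (let_norm; reflexivity).
  apply comp_monor, fmap_π1_pairL, discardable.
Qed.

End Substitution.

(** * The induction on expressions *)

Theorem theorem4p7 (M : cbpv_model)
  (discardable : forall (X Y : M) (f : X ~> mon Y), lax_discardable f)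
  (copyable : forall (X Y : M) (f : X ~> mon Y), lax_copyable f)
  (central : forall (X Y : M) (f : X ~> mon Y), lax_central f)
  (Γ : ctx) (τ : ty) (e : expr Γ τ) :
  cbv_sem e (M := M) ⋉ cbn_sem e (M := M).
Proof.
induction e as [Γ τ x|Γ|Γ τ1 τ2 e1 IH1 e2 IH2|Γ τ1 τ2 e IH|Γ τ1 τ2 e IH|Γ|Γ
  |Γ τ e0 IH0 e1 IH1 e2 IH2|Γ τ τ' e IH|Γ τ τ' e IH e' IH'];
  intros W fv fn rf; simpl.
- rewrite cbn_var_tuple.
  eapply rel_le; [apply cbv_var_tuple, discardable|apply le_refl|apply rf].
- rewrite <- (comp_assoc _ _ (cbn_tuple fn)), bang_comp.
  apply lift_const, discardable.
- specialize (IH1 W fv fn rf); specialize (IH2 W fv fn rf).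
  set (t := cbv_tuple fv) in *; set (u := cbn_tuple fn) in *.
  split.
  + replace (π1 ∘ _) with (cbn_sem e1 ∘ u)
      by (rewrite comp_assoc; f_equal; symmetry; apply pair_π1).
    (* Call-by-value also runs the other component, which is discarded. *)
    eapply rel_le; [|apply le_refl|exact IH1].
    rewrite comp_assoc, fmap_lift, !lift_let.
    apply comp_monol, let_mono; [apply le_refl|].
    apply comp_monol, fmap_π1_pairL, discardable.
  + replace (π2 ∘ _) with (cbn_sem e2 ∘ u)
      by (rewrite comp_assoc; f_equal; symmetry; apply pair_π2).
    eapply rel_le; [|apply le_refl|exact IH2].
    rewrite comp_assoc, fmap_lift, !lift_let.
    apply comp_monol, let_mono; [apply le_refl|].
    apply comp_monol, fmap_π2_pairL, discardable.
- destruct (IH W fv fn rf) as [r _].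
  rewrite comp_assoc, fmap_lift in r; rewrite <- comp_assoc; exact r.
- destruct (IH W fv fn rf) as [_ r].
  rewrite comp_assoc, fmap_lift in r; rewrite <- comp_assoc; exact r.
- rewrite <- (comp_assoc _ _ (cbn_tuple fn)), bang_comp.
  apply lift_const, discardable.
- rewrite <- (comp_assoc _ _ (cbn_tuple fn)), bang_comp.
  apply lift_const, discardable.
- specialize (IH0 W fv fn rf); specialize (IH1 W fv fn rf);
    specialize (IH2 W fv fn rf).
  set (t := cbv_tuple fv) in *; set (u := cbn_tuple fn) in *.
  (* In the intermediate terms the arguments run once for the scrutinee and again in the chosen
     branch. *)
  apply rel_le with (fv := let_ (lift (cbv_sem e0) ∘ t)
      (two_case (lift (cbv_sem e1) ∘ t) (lift (cbv_sem e2) ∘ t)))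
    (fn := alet (Z := cbn_ty τ) (cbn_sem e0 ∘ u)
      (two_case (cbn_sem e1 ∘ u) (cbn_sem e2 ∘ u))).
  + rewrite <- let_two_case.
    eapply le_trans; [|eapply le_trans; [apply (let_duplicate (t := t)
      (cbv_sem e0) (two_case (cbv_sem e1) (cbv_sem e2) ∘ swap)); auto|]].
    * change (bind ?g ∘ ⟨idm _, ?f⟩) with (let_ f g); let_norm; apply le_refl.
    * let_norm; apply le_refl.
  + change (aext (cbn_ty τ) ?g ∘ ⟨idm _, ?f⟩) with (alet (Z := cbn_ty τ) f g).
    rewrite alet_comp, <- two_case_nat; cat_norm; apply le_refl.
  (* [rel_let] wants the same bound computation on both sides. At [ty_bool] the relation is the
     order, so [IH0] allows the call-by-name scrutinee to replace the call-by-value one. *)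
  + eapply rel_le; [apply let_mono; [exact IH0|apply le_refl]|apply le_refl|].
    apply rel_let, rel_two_case; assumption.
- intros W' w gv gn rg.
  (* Extend the reindexed arguments by the argument of the function. *)
  pose (fv' := var_case (P := fun σ _ => W' ~> mon (cbv_ty σ)) gv
    (fun σ x => fv σ x ∘ w)).
  pose (fn' := var_case (P := fun σ _ => W' ~> cbn_ty σ) gn
    (fun σ x => fn σ x ∘ w)).
  assert (rf' : forall σ x, rel (fv' σ x) (fn' σ x)).
  { apply var_case; [exact rg|intros σ x; apply rel_comp, rf]. }
  specialize (IH W' fv' fn' rf'); simpl in IH.
  rewrite <- cbv_tuple_comp, <- cbn_tuple_comp in IH.
  set (t := cbv_tuple fv) in *; set (u := cbn_tuple fn) in *.
  rewrite <- (comp_assoc _ u w), ev_curry.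
  (* Both sides are now equal to those of [IH]: an abstraction returns at once, so the old arguments
     run, then [gv], then the body. *)
  revert IH; let_norm; rewrite ev_curry; exact (fun r => r).
- specialize (IH W fv fn rf W (idm W) _ _ (IH' W fv fn rf)).
  set (t := cbv_tuple fv) in *; set (u := cbn_tuple fn) in *.
  eapply rel_le; [| |exact IH].
  (* [k] is what follows the evaluation of [e]: run [e'] and apply. Duplication gives [e'] its own
     run of the arguments. *)
  + pose (k := let_ (cbv_sem (M := M) e' ∘ π2)
      (ev (X := cbv_ty τ) (Y := mon (cbv_ty τ')) ∘ ⟨π1 ∘ π1, π2⟩)).
    eapply le_trans; [|eapply le_trans;
      [apply (let_duplicate (t := t) (cbv_sem e) k); auto|]]; unfold k.
    * let_norm; apply le_refl.
    * let_norm; apply le_refl.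
  + cat_norm; apply le_refl.
Qed.
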